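(* Let $n\ge2$ be an integer and $\eta>0$ real. For each row $i=2,\ldots,n$, let $Z_i=(Z_{i1},\ldots,Z_{i,i-1})^\prime\sim N_{i-1}(0,I_{i-1})$ and $G_i\sim\chi^2_{n+2\eta-i}$ be independent, with the pairs $(Z_i,G_i)$ mutually independent across rows. Define $$ T_{ij}=\sum_{k=j+1}^{i-1}Z_{ik}^2+G_i,\quad j=0,1,\ldots,i-1,\qquad P_{ij}=\frac{Z_{ij}}{\bigl(Z_{ij}^2+T_{ij}\bigr)^{1/2}}=\frac{Z_{ij}}{T_{i,j-1}^{1/2}},\quad j=1,\ldots,i-1, $$ and $S_i=(Z_i^\prime Z_i+G_i)^{1/2}$. Let $L$ be the normalized-Bartlett factor: $L_{11}=1$, $L_{ij}=Z_{ij}/S_i$ for $1\le j<i$, $L_{ii}=G_i^{1/2}/S_i$ for $i=2,\ldots,n$, and $L_{ij}=0$ for $j>i$. Then, for each row $i=2,\ldots,n$: (i) the $P_{ij}$, $j=1,\ldots,i-1$, are mutually independent, and $P_{ij}\overset{d}{=}2V-1$ with $V\sim\operatorname{Beta}(\beta_j,\beta_j)$, $\beta_j=\eta+(n-1-j)/2$; this is exactly the tree-$j$ law of the C-vine sampler for $\operatorname{LKJ}_n(\eta)$; (ii) the vine construction applied with partial correlations $\rho_{ji;1\cdots j-1}=P_{ij}$ returns the normalized-Bartlett row almost surely: for $1\le j<i$, $$ P_{ij}\prod_{k=1}^{j-1}\bigl(1-P_{ik}^2\bigr)^{1/2}=\frac{Z_{ij}}{S_i}=L_{ij},\qquad \prod_{k=1}^{i-1}\bigl(1-P_{ik}^2\bigr)^{1/2}=\frac{G_i^{1/2}}{S_i}=L_{ii}.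 $$ The couplings are independent across rows, so the array $\{P_{ij}:1\le j<i\le n\}$ has exactly the joint input law of the C-vine sampler, and the C-vine sampler driven by it produces the normalized-Bartlett factor $L$ pathwise (almost surely).
   Context: $\operatorname{Gamma}(\alpha,\theta)$ is the Gamma distribution with shape $\alpha$ and scale $\theta$; for real $a>0$, $\chi^2_a\equiv\operatorname{Gamma}(a/2,2)$. A prime denotes transpose; empty sums are $0$ and empty products are $1$. $\operatorname{LKJ}_n(\eta)$ is the distribution on $n\times n$ correlation matrices $C$ with density proportional to $\det(C)^{\eta-1}$ with respect to Lebesgue measure in the $n(n-1)/2$ off-diagonal coordinates. C-vine sampler for $\operatorname{LKJ}_n(\eta)$: the inputs are partial correlations $\rho_{ji;1\cdots j-1}$, $1\le j<i\le n$, that are mutually independent with $\rho_{ji;1\cdots j-1}\overset{d}{=}2V-1$, $V\sim\operatorname{Beta}(\beta_j,\beta_j)$, $\beta_j=\eta+(n-1-j)/2$ ($j$ is the tree index). The output is the lower-triangular Cholesky factor $L$ with $L_{11}=1$ and, for $1\le j<i\le n$, $$ L_{ij}=\rho_{ji;1\cdots j-1}\prod_{k=1}^{j-1}\bigl(1-\rho_{ki;1\cdots k-1}^2\bigr)^{1/2},\qquad L_{ii}=\prod_{k=1}^{i-1}\bigl(1-\rho_{ki;1\cdots k-1}^2\bigr)^{1/2}. $$ *)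

(* Defs.v *)
From HB Require Import structures.
From mathcomp Require Import all_boot all_order all_algebra finmap.
From mathcomp Require Import all_classical all_reals all_analysis.

Set Implicit Arguments.
Unset Strict Implicit.
Unset Printing Implicit Defensive.

Import Order.TTheory GRing.Theory Num.Theory.
Import numFieldNormedType.Exports.

Local Open Scope classical_set_scope.
Local Open Scope ring_scope.

(* Rows and columns are numbered from 1, by natural numbers: the coordinates of
   v : m.-tuple R are vcoord v 1, ..., vcoord v m. *)
Definition vcoord (R : realType) (m : nat) (v : m.-tuple R) (j : nat) : R :=
  nth 0 v j.-1.

Section laws.
Context {R : realType}.
Local Notation mu := (@lebesgue_measure R).

Definition gamma_fun (a : R) : R :=
  \int[mu]_(x in `]0, +oo[) (x `^ (a - 1) * expR (- x)).

(* Shape [alpha], scale [theta]. *)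
Definition gamma_pdf (alpha theta x : R) : R :=
  if 0 < x then
    x `^ (alpha - 1) * expR (- (x / theta)) /
      (gamma_fun alpha * theta `^ alpha)
  else 0.

Definition gamma_law (alpha theta : R) (A : set R) : \bar R :=
  (\int[mu]_(x in A) (gamma_pdf alpha theta x)%:E)%E.

Definition chi2_law (a : R) : set R -> \bar R := gamma_law (a / 2) 2.

(* The library's [beta_prob] only takes natural parameters. *)
Definition rbeta_fun (a b : R) : R :=
  \int[mu]_(x in `]0, 1[) (x `^ (a - 1) * (1 - x) `^ (b - 1)).

Definition rbeta_pdf (a b x : R) : R :=
  if 0 < x < 1 then x `^ (a - 1) * (1 - x) `^ (b - 1) / rbeta_fun a b else 0.

Definition rbeta_law (a b : R) (A : set R) : \bar R :=
  (\int[mu]_(x in A) (rbeta_pdf a b x)%:E)%E.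

End laws.

Section probability_notions.
Context {d : measure_display} {Omega : measurableType d} {R : realType}.
Variable Pr : probability Omega R.

Definition has_law (X : Omega -> R) (law : set R -> \bar R) : Prop :=
  measurable_fun setT X /\
  forall A, measurable A -> pushforward Pr X A = law A.

(* Mutual independence of the families of events F i, i in D.  Random elements
   X i are mutually independent when the sigma-algebras
   [g_sigma_algebra_preimage (X i)] they generate are; the first conjunct then
   says that every X i is measurable. *)
Definition mutually_independent (I : choiceType) (D : set I)
    (F : I -> set_system Omega) : Prop :=
  (forall i, D i -> F i `<=` measurable) /\
  forall (J : {fset I}) (E : I -> set Omega),
    (forall i, i \in J -> D i /\ F i (E i)) ->
    Pr (\bigcap_(i in [set` J]) E i) = (\prod_(i <- J) Pr (E i))%E.

Definition independent2 (d1 d2 : measure_display)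
    (T1 : measurableType d1) (T2 : measurableType d2)
    (X : Omega -> T1) (Y : Omega -> T2) : Prop :=
  forall A B, measurable A -> measurable B ->
    Pr (X @^-1` A `&` Y @^-1` B) = (Pr (X @^-1` A) * Pr (Y @^-1` B))%E.

(* N_m(0, I_m): the coordinates are independent and N(0, 1). *)
Definition std_normal_vector (m : nat) (X : Omega -> m.-tuple R) : Prop :=
  mutually_independent [set j | 1 <= j <= m]%N
    (fun j => g_sigma_algebra_preimage (fun w => vcoord (X w) j)) /\
  forall j, (1 <= j <= m)%N ->
    has_law (fun w => vcoord (X w) j) (normal_prob 0 1).

End probability_notions.

Section cvine.
Context {R : realType}.

Definition beta_par (n : nat) (eta : R) (j : nat) : R :=
  eta + (n%:R - 1 - j%:R) / 2.

(* The law of 2V - 1 where V ~ Beta(beta_j, beta_j). *)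
Definition cvine_tree_law (n : nat) (eta : R) (j : nat) : set R -> \bar R :=
  pushforward (rbeta_law (beta_par n eta j) (beta_par n eta j))
    (fun v : R => 2 * v - 1).

(* [rho j i] stands for the partial correlation rho_{ji;1...j-1}. *)
Definition cvine_entry (rho : nat -> nat -> R) (i j : nat) : R :=
  if (j < i)%N then
    rho j i * \prod_(1 <= k < j) Num.sqrt (1 - rho k i ^+ 2)
  else if i == j then \prod_(1 <= k < i) Num.sqrt (1 - rho k i ^+ 2)
  else 0.

Definition cvine_factor (n : nat) (rho : nat -> nat -> R) : 'M[R]_n :=
  \matrix_(i < n, j < n) cvine_entry rho i.+1 j.+1.

(* The joint law of the inputs of the C-vine sampler for LKJ_n(eta), for a
   random array [rho j i] indexed by 1 <= j < i <= n. *)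
Definition cvine_input (d : measure_display) (Omega : measurableType d)
    (Pr : probability Omega R) (n : nat) (eta : R)
    (rho : nat -> nat -> Omega -> R) : Prop :=
  mutually_independent Pr [set ji | [&& 1 <= ji.1, ji.1 < ji.2 & ji.2 <= n]]%N
    (fun ji : nat * nat => g_sigma_algebra_preimage (rho ji.1 ji.2)) /\
  forall j i, [&& 1 <= j, j < i & i <= n]%N ->
    has_law Pr (rho j i) (cvine_tree_law n eta j).

End cvine.

(* Deterministic functions of the realized rows z i = (z_i1, ..., z_i,i-1) and
   g i, for 2 <= i <= n; the values at i = 0, 1 are never used. *)
Section bartlett.
Context {R : realType}.
Variables (z : forall i : nat, i.-1.-tuple R) (g : nat -> R).

Definition Tsum (i j : nat) : R :=
  \sum_(j.+1 <= k < i) vcoord (z i) k ^+ 2 + g i.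

Definition Pcor (i j : nat) : R :=
  vcoord (z i) j / Num.sqrt (vcoord (z i) j ^+ 2 + Tsum i j).

Definition Snorm (i : nat) : R :=
  Num.sqrt (\sum_(1 <= k < i) vcoord (z i) k ^+ 2 + g i).

Definition bartlett_entry (i j : nat) : R :=
  if (i < j)%N then 0
  else if (j < i)%N then vcoord (z i) j / Snorm i
  else if i == 1%N then 1 else Num.sqrt (g i) / Snorm i.

Definition bartlett_factor (n : nat) : 'M[R]_n :=
  \matrix_(i < n, j < n) bartlett_entry i.+1 j.+1.

Definition Pcor_row (i : nat) : i.-1.-tuple R :=
  [tuple Pcor i j.+1 | j < i.-1].

Definition bartlett_row (i : nat) : i.-tuple R :=
  [tuple bartlett_entry i j.+1 | j < i].

End bartlett.

(* Main.v *)
Require Import Defs.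
From HB Require Import structures.
From mathcomp Require Import all_boot all_order all_algebra finmap.
From mathcomp Require Import all_classical all_reals all_analysis.
From mathcomp Require Import measurable_realfun ring lra.

Set Implicit Arguments.
Unset Strict Implicit.
Unset Printing Implicit Defensive.

Import Order.TTheory GRing.Theory Num.Theory.
Import numFieldNormedType.Exports.

Local Open Scope classical_set_scope.
Local Open Scope ring_scope.

(** Fix a row [i] and put [T_j = Z_(i,j+1)^2 + ... + Z_(i,i-1)^2 + G_i], so that
    [T_(j-1) = Z_ij^2 + T_j] and [P_ij = Z_ij / sqrt T_(j-1)].

    The laws come from one fact about a standard normal [Z] and an independent
    [T ~ Gamma(a, 2)]: the ratio [Z / sqrt (Z^2 + T)] and the sum [Z^2 + T] are
    independent, the ratio has density proportional to [(1 - p^2)^(a - 1)],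
    which is that of [2 V - 1] for [V ~ Beta(a, a)], and the sum is
    [Gamma(a + 1/2, 2)]; see [normal_gamma_law].  The change of variables
    [(z, t) -> (p, s)] is done one coordinate at a time under Tonelli: for fixed
    [z] translate by [t = s - z^2], then for fixed [s] scale by [z = p sqrt s].
    After that the density is a product of a function of [p] and a function of
    [s].  The normalising constants need no separate computation: the joint law
    has mass 1, so both factors have finite positive mass.

    Starting from [T_(i-1) = G_i] and going down in [j], each step replaces the
    independent pair [(Z_ij, T_j)] by the independent pair [(P_ij, T_(j-1))],
    whatever the event built from the [Z_ik], [k < j], and the [P_ik], [k > j],
    on which one restricts.  The shape parameter of [T_j] is [beta_par n eta j]:
    it starts at half of [n + 2 eta - i], for [j = i - 1], and grows by 1/2 at
    each step, which is how the shape of the tree-[j] law arises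
    ([tail_ratio_joint_law], [bartlett_row_law]).

    The pathwise identities hold as soon as [G_i > 0], hence almost surely:
    [1 - P_ik^2 = T_k / T_(k-1)], so the products of the sampler telescope
    ([prod_sqrt_tail_ratio]).

    Across rows, [P_ij] and [L_ij] are measurable functions of [(Z_i, G_i)], so
    independence of rows is inherited; independence of the whole array follows
    from independence within rows by grouping the events by row
    ([mutually_independent_grouped]). *)

(** * Affine changes of variable *)

(** Scaling the image of Lebesgue measure under [x |-> a x + b] by [a] gives
    the right mass to every interval, hence is Lebesgue measure. *)
Lemma ge0_integral_affine (R : realType) (a b : R) (f : R -> \bar R) :
  0 < a -> measurable_fun [set: R] f -> (forall x, 0 <= f x)%E ->
  (\int[lebesgue_measure]_x f x =
   a%:E * \int[lebesgue_measure]_x f (a * x + b)%R)%E.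
Proof.
move=> a0 mf f0.
pose phi : measurableTypeR R -> measurableTypeR R := fun x => a * x + b.
have mphi : measurable_fun setT phi.
  by apply: measurable_funD => //; exact: mulrl_measurable.
have munu (A : set (measurableTypeR R)) : measurable A ->
    lebesgue_measure A =
    mscale (NngNum (ltW a0)) (pushforward (@lebesgue_measure R) phi) A.
  move=> mA; apply: lebesgue_measure_unique => //= _ [[x y]] _ <-.
  rewrite /mscale /pushforward/=.
  have phiE : phi @^-1` `]x, y] = `](x - b) / a, (y - b) / a]%classic.
    apply/seteqP; split => t; rewrite /phi /= !in_itv/= ltr_pdivrMr// ler_pdivlMr//;
      by rewrite ltrBlDr lerBrDr (mulrC t).
  rewrite [X in _ = (_ * X)%E](_ : _ = lebesgue_measure (phi @^-1` `]x, y]))//.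
  rewrite phiE !lebesgue_measure_itv/= !lte_fin ltr_pM2r ?invr_gt0// ltrD2r.
  case: ifPn => // _; last by rewrite mule0.
  by rewrite -!EFinD -EFinM; congr EFin; field; rewrite gt_eqF.
rewrite (@eq_measure_integral _ _ _ _ (mscale (NngNum (ltW a0))
  (pushforward (@lebesgue_measure R) phi)))//=; last first.
  by move=> A mA _; exact: munu.
rewrite ge0_integral_mscale//=.
by rewrite ge0_integral_pushforward//; congr (_ * _)%E.
Qed.

Lemma ge0_integral_affine_preimage (R : realType) (a b : R) (f : R -> \bar R)
    (A : set R) :
  0 < a -> measurable A -> measurable_fun [set: R] f ->
  (forall x, 0 <= f x)%E ->
  (\int[lebesgue_measure]_(x in A) f x =
   a%:E * \int[lebesgue_measure]_(x in (fun x => a * x + b)%R @^-1` A)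
            f (a * x + b)%R)%E.
Proof.
move=> a0 mA mf f0; rewrite integral_mkcond (@ge0_integral_affine _ a b)//.
- by rewrite [in RHS]integral_mkcond.
- by apply/(measurable_restrictT _ _).1 => //; exact: measurable_funTS.
- by move=> x; rewrite patchE; case: ifP.
Qed.

(** * Gamma and beta laws as normalised kernels *)

Definition gamma_kernel (R : realType) (a s : R) : R :=
  if 0 < s then s `^ (a - 1) * expR (- (s / 2)) else 0.

(** The unnormalised density of [2 V - 1] for [V ~ Beta(a, a)]; the condition
    [p ^+ 2 < 1] is also the one under which [s - s p^2] is positive for
    [s > 0]. *)
Definition beta_kernel (R : realType) (a p : R) : R :=
  if p ^+ 2 < 1 then (1 - p ^+ 2) `^ (a - 1) else 0.

(** Laws are compared through their kernels only, whatever the closed form of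
    the normalising constant.  When the kernel has infinite mass, [fine] and
    the inverse send it to the zero law, exactly as the real-valued integrals in
    the gamma and beta densities do. *)
Definition normalized_law (R : realType) (f : R -> R) (A : set R) : \bar R :=
  ((fine (\int[lebesgue_measure]_x (f x)%:E))^-1%:E *
   \int[lebesgue_measure]_(x in A) (f x)%:E)%E.

Lemma gamma_kernel_ge0 (R : realType) (a s : R) : 0 <= gamma_kernel a s.
Proof.
by rewrite /gamma_kernel; case: ifP => // _; rewrite mulr_ge0 ?powR_ge0 ?expR_ge0.
Qed.

Lemma beta_kernel_ge0 (R : realType) (a p : R) : 0 <= beta_kernel a p.
Proof. by rewrite /beta_kernel; case: ifP => // _; rewrite powR_ge0. Qed.

Lemma measurable_gamma_kernel (R : realType) (a : R) :
  measurable_fun [set: R] (gamma_kernel a).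
Proof.
apply: measurable_fun_ifT => //=; first exact: measurable_fun_ltr.
apply: measurable_funM.
  exact: (measurable_powR (a - 1)).
apply: measurableT_comp; first exact: measurable_expR.
apply: (measurable_funN (f := fun x : R => x / 2)).
exact: mulrr_measurable.
Qed.

Lemma measurable_beta_kernel (R : realType) (a : R) :
  measurable_fun [set: R] (beta_kernel a).
Proof.
apply: measurable_fun_ifT => //=; first exact: measurable_fun_ltr.
apply: (@measurableT_comp _ _ _ _ _ _ (fun x : R => x `^ (a - 1))).
  exact: (measurable_powR (a - 1)).
exact: measurable_funB.
Qed.

(** At infinity both sides are 0. *)
Lemma fineZl (R : realType) (k : R) (x : \bar R) :
  0 < k -> fine (k%:E * x) = k * fine x.
Proof.
move=> k0; case: x => [r| |]//=; rewrite ?mulr0.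
- by rewrite gt0_muley ?lte_fin.
- by rewrite gt0_muleNy ?lte_fin.
Qed.

(** Substituting [2 x] for [x] turns [exp (- x / 2)] into [exp (- x)] and
    produces the factor [2 * 2 `^ (a - 1)]. *)
Lemma fine_integral_gamma_kernel (R : realType) (a : R) :
  fine (\int[lebesgue_measure]_x (gamma_kernel a x)%:E) = gamma_fun a * 2 `^ a.
Proof.
rewrite (@ge0_integral_affine _ 2 0)//; last 2 first.
  by apply/measurable_EFinP; exact: measurable_gamma_kernel.
  by move=> x; rewrite lee_fin gamma_kernel_ge0.
have -> : (\int[lebesgue_measure]_x (gamma_kernel a (2 * x + 0))%:E =
  (2 `^ (a - 1))%:E *
    \int[lebesgue_measure]_(x in `]0%R, +oo[) (x `^ (a - 1) * expR (- x))%:E)%E.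
  rewrite [in RHS]integral_mkcond -ge0_integralZl//=; last 2 first.
  - apply/(measurable_restrictT _ _).1 => //.
    apply/measurable_EFinP; apply: measurable_funTS.
    apply: measurable_funM; first exact: (measurable_powR (a - 1)).
    exact: measurableT_comp.
  - move=> x _; rewrite patchE; case: ifP => // _.
    by rewrite lee_fin mulr_ge0 ?powR_ge0 ?expR_ge0.
  apply: eq_integral => x _; rewrite patchE addr0 /gamma_kernel.
  rewrite pmulr_rgt0// mem_setE in_itv/= andbT.
  case: ifPn => x0; last by rewrite mule0.
  rewrite -EFinM powRM ?(ltW x0)// -mulrA; congr (_ * (_ * expR (- _)))%:E.
  by rewrite mulrC mulKf.
rewrite !fineZl ?powR_gt0//= mulrA -{1}(@powRr1 _ 2)// -powRD; last first.
  by rewrite pnatr_eq0/= implybT.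
by rewrite addrC subrK mulrC.
Qed.

Lemma gamma_law2E (R : realType) (a : R) (A : set R) : measurable A ->
  gamma_law a 2 A = normalized_law (gamma_kernel a) A.
Proof.
move=> mA; rewrite /normalized_law -ge0_integralZl//=.
- apply: eq_integral => x _; rewrite fine_integral_gamma_kernel /gamma_pdf.
  rewrite /gamma_kernel -EFinM; case: ifP => _; last by rewrite mulr0.
  by rewrite mulrC.
- by apply/measurable_EFinP/measurable_funTS; exact: measurable_gamma_kernel.
- by move=> x _; rewrite lee_fin gamma_kernel_ge0.
- rewrite lee_fin invr_ge0 fine_ge0// integral_ge0// => x _.
  by rewrite lee_fin gamma_kernel_ge0.
Qed.

Definition unit_beta_kernel (R : realType) (a v : R) : R :=
  if 0 < v < 1 then v `^ (a - 1) * (1 - v) `^ (a - 1) else 0.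

Lemma unit_beta_kernel_ge0 (R : realType) (a v : R) : 0 <= unit_beta_kernel a v.
Proof.
by rewrite /unit_beta_kernel; case: ifP => // _; rewrite mulr_ge0 ?powR_ge0.
Qed.

Lemma measurable_unit_beta_kernel (R : realType) (a : R) :
  measurable_fun [set: R] (unit_beta_kernel a).
Proof.
apply: measurable_fun_ifT => //=.
  by apply: measurable_and; exact: measurable_fun_ltr.
apply: measurable_funM; first exact: (measurable_powR (a - 1)).
apply: (@measurableT_comp _ _ _ _ _ _ (fun x : R => x `^ (a - 1))).
  exact: (measurable_powR (a - 1)).
exact: measurable_funB.
Qed.

(** With [p = 2 v - 1], [1 - p^2 = 4 v (1 - v)]. *)
Lemma integral_beta_kernel_rbeta (R : realType) (a : R) (A : set R) :
  measurable A ->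
  (\int[lebesgue_measure]_(x in A) (beta_kernel a x)%:E =
   (2 * 4 `^ (a - 1))%:E *
   \int[lebesgue_measure]_(v in (fun v => 2 * v - 1)%R @^-1` A)
     (unit_beta_kernel a v)%:E)%E.
Proof.
move=> mA; rewrite (@ge0_integral_affine_preimage _ 2 (-1))//; last 2 first.
  by apply/measurable_EFinP; exact: measurable_beta_kernel.
  by move=> x; rewrite lee_fin beta_kernel_ge0.
rewrite EFinM -muleA; congr (_ * _)%E.
have mphi : measurable ((fun v : R => 2 * v - 1) @^-1` A).
  rewrite -[X in measurable X]setTI.
  by apply: (measurable_funB (mulrl_measurable _) (@measurable_cst _ _ _ _ _ _)).
rewrite -ge0_integralZl//=.
- apply: eq_integral => v _; rewrite /beta_kernel /unit_beta_kernel -EFinM; congr EFin.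
  have -> : 1 - (2 * v - 1) ^+ 2 = 4 * (v * (1 - v)) by ring.
  have -> : ((2 * v - 1) ^+ 2 < 1) = (0 < v < 1).
    by apply/idP/idP => [?|/andP[? ?]]; [apply/andP; split; nra | nra].
  case: ifP => [/andP[v0 v1]|_]; last by rewrite mulr0.
  by rewrite !powRM ?mulr_ge0 ?subr_ge0 ?ltW.
- by apply/measurable_EFinP/measurable_funTS; exact: measurable_unit_beta_kernel.
- by move=> v _; rewrite lee_fin unit_beta_kernel_ge0.
Qed.

(** The factor [2 * 4 `^ (a - 1)] of the substitution cancels between the kernel
    and its normalisation. *)
Lemma cvine_tree_lawE (R : realType) (n j : nat) (eta : R) (A : set R) :
  measurable A ->
  cvine_tree_law n eta j A = normalized_law (beta_kernel (beta_par n eta j)) A.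
Proof.
move=> mA; rewrite /cvine_tree_law /pushforward /rbeta_law /normalized_law.
set a := beta_par n eta j.
rewrite !integral_beta_kernel_rbeta// preimage_setT fineZl ?mulr_gt0 ?powR_gt0//.
rewrite muleA -EFinM invfM -mulrA (mulrC (fine _)^-1) mulrA mulVf ?mul1r; last first.
  by rewrite gt_eqF// mulr_gt0 ?powR_gt0.
have rbetaE : rbeta_fun a a =
    fine (\int[lebesgue_measure]_v (unit_beta_kernel a v)%:E).
  rewrite /rbeta_fun /Rintegral [in LHS]integral_mkcond; congr fine.
  apply: eq_integral => x _; rewrite patchE mem_setE in_itv/= /unit_beta_kernel.
  by case: ifP.
have mphi : measurable ((fun v : R => 2 * v - 1) @^-1` A).
  rewrite -[X in measurable X]setTI.
  by apply: (measurable_funB (mulrl_measurable _) (@measurable_cst _ _ _ _ _ _)).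
rewrite -ge0_integralZl//=.
- apply: eq_integral => v _; rewrite /rbeta_pdf rbetaE /unit_beta_kernel -EFinM.
  by case: ifP => _; rewrite ?mulr0// mulrC.
- by apply/measurable_EFinP/measurable_funTS; exact: measurable_unit_beta_kernel.
- by move=> v _; rewrite lee_fin unit_beta_kernel_ge0.
- rewrite lee_fin invr_ge0 fine_ge0// integral_ge0// => x _.
  by rewrite lee_fin unit_beta_kernel_ge0.
Qed.

(** * The beta-gamma identity for a normal variable *)

Lemma integral_mulr_indic (R : realType) (f : R -> R) (A : set R) :
  (\int[lebesgue_measure]_(x in A) (f x)%:E =
   \int[lebesgue_measure]_x (f x * \1_A x)%:E)%E.
Proof.
rewrite integral_mkcond; apply: eq_integral => x _.
by rewrite patchE indicE; case: ifP => _; rewrite ?mulr1 ?mulr0.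
Qed.

Lemma measurable_sqrt (R : realType) : measurable_fun [set: R] Num.sqrt.
Proof. by apply: continuous_measurable_fun => x; exact: sqrt_continuous. Qed.

(** The inverse of a nonnegative number is its power of exponent -1 (0 included),
    and powers are measurable. *)
Lemma measurable_fun_div_sqrt d (T : measurableType d) (R : realType)
    (f g : T -> R) :
  measurable_fun [set: T] f -> measurable_fun [set: T] g ->
  measurable_fun [set: T] (fun x => f x / Num.sqrt (g x)).
Proof.
move=> mf mg; apply: measurable_funM => //.
rewrite [X in measurable_fun _ X](_ : _ = (@powR R ^~ (-1)) \o (Num.sqrt \o g)).
  apply: measurableT_comp; first exact: (measurable_powR (-1)).
  apply: measurableT_comp mg; exact: measurable_sqrt.
by apply/funext => x /=; rewrite powR_inv1// sqrtr_ge0.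
Qed.

(** At [z = p sqrt s] the exponentials combine to [exp (- s / 2)], and
    [sqrt s * s^(a - 1) = s^(a + 1/2 - 1)]: the joint density of the ratio and
    the sum is a product. *)
Lemma scaled_normal_gamma_density (R : realType) (a s p : R) : 0 < s ->
  Num.sqrt s * (normal_pdf 0 1 (Num.sqrt s * p) *
    gamma_kernel a (s - (Num.sqrt s * p) ^+ 2)) =
  normal_peak 1 * gamma_kernel (a + 2^-1) s * beta_kernel a p.
Proof.
move=> s0; rewrite normal_pdfE ?oner_eq0// /normal_fun subr0 expr1n.
rewrite exprMn sqr_sqrtr ?(ltW s0)// /gamma_kernel /beta_kernel s0.
have -> : s - s * p ^+ 2 = s * (1 - p ^+ 2) by ring.
rewrite pmulr_rgt0// subr_gt0.
case: ifPn => p1; last by rewrite !mulr0.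
rewrite powRM ?(ltW s0) ?subr_ge0 ?(ltW p1)//.
rewrite (_ : a + 2^-1 - 1 = 2^-1 + (a - 1)); last by ring.
rewrite (@powRD _ s 2^-1 (a - 1)); last by rewrite (gt_eqF s0) implybT.
rewrite powR12_sqrt ?(ltW s0)//.
rewrite (_ : - (s / 2) = - (s * p ^+ 2) / 2 + - (s * (1 - p ^+ 2) / 2)); last by field.
rewrite expRD; ring.
Qed.

(** The joint mass of the ratio in [B] and the sum in [C], for the unnormalised
    gamma kernel: translation in [t] for fixed [z], exchange of the integrals,
    scaling in [z] for fixed [s]. *)
Lemma normal_gamma_integral (R : realType) (a : R) (B C : set R) :
  measurable B -> measurable C ->
  (\int[lebesgue_measure]_z ((normal_pdf 0 1 z)%:E *
     \int[lebesgue_measure]_(t in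
         (fun t : R => z / Num.sqrt (z ^+ 2 + t))%R @^-1` B `&`
         (fun t : R => z ^+ 2 + t)%R @^-1` C)
       (gamma_kernel a t)%:E) =
   (normal_peak 1)%:E *
   (\int[lebesgue_measure]_(p in B) (beta_kernel a p)%:E *
    \int[lebesgue_measure]_(s in C) (gamma_kernel (a + 2^-1) s)%:E))%E.
Proof.
move=> mB mC.
(* The joint density after the translation t = s - z^2, cut down to B and C. *)
pose F (zs : R * R) : R := normal_pdf 0 1 zs.1 *
  (gamma_kernel a (zs.2 - zs.1 ^+ 2) * (\1_B (zs.1 / Num.sqrt zs.2) * \1_C zs.2)).
have F0 zs : (0 <= (F zs)%:E)%E.
  by rewrite lee_fin !mulr_ge0 ?normal_pdf_ge0 ?gamma_kernel_ge0.
have mF : measurable_fun [set: R * R] (fun zs => (F zs)%:E).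
  apply/measurable_EFinP; apply: measurable_funM.
    by apply: measurableT_comp => //; exact: measurable_normal_pdf.
  apply: measurable_funM.
    apply: (@measurableT_comp _ _ _ _ _ _ (gamma_kernel a)).
      exact: measurable_gamma_kernel.
    by apply: measurable_funB => //; exact: measurable_funX.
  apply: measurable_funM.
    apply: (@measurableT_comp _ _ _ _ _ _ (\1_B : R -> R)).
      exact: measurable_indic.
    exact: measurable_fun_div_sqrt.
  by apply: (@measurableT_comp _ _ _ _ _ _ (\1_C : R -> R)).
transitivity (\int[lebesgue_measure]_z \int[lebesgue_measure]_s (F (z, s))%:E)%E.
  apply: eq_integral => z _.
  have mS : measurable_fun [set: R] (fun t : R => z ^+ 2 + t) by exact: measurable_funD.
  have mD : measurable ((fun t : R => z / Num.sqrt (z ^+ 2 + t)) @^-1` B `&`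
      (fun t : R => z ^+ 2 + t) @^-1` C).
    apply: measurableI; rewrite -[X in measurable X]setTI; last exact: mS.
    by apply: measurable_fun_div_sqrt.
  (* t = s - z^2 *)
  rewrite (@ge0_integral_affine_preimage _ 1 (- z ^+ 2))//; last 2 first.
  - by apply/measurable_EFinP; exact: measurable_gamma_kernel.
  - by move=> x; rewrite lee_fin gamma_kernel_ge0.
  rewrite mul1e (_ : _ @^-1` _ = (fun s => z / Num.sqrt s) @^-1` B `&` C); last first.
    by apply/seteqP; split => s /=; rewrite mul1r addrC subrK.
  have mBC : measurable ((fun s => z / Num.sqrt s) @^-1` B `&` C).
    apply: measurableI => //; rewrite -[X in measurable X]setTI.
    by apply: measurable_fun_div_sqrt.
  rewrite -ge0_integralZl//=; last 3 first.
  - apply/measurable_EFinP; apply: measurable_funTS.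
    apply: (@measurableT_comp _ _ _ _ _ _ (gamma_kernel a)).
      exact: measurable_gamma_kernel.
    by apply: measurable_funD => //; exact: mulrl_measurable.
  - by move=> x _; rewrite lee_fin gamma_kernel_ge0.
  - by rewrite lee_fin normal_pdf_ge0.
  under eq_integral do rewrite -EFinM.
  rewrite integral_mulr_indic; apply: eq_integral => s _; congr EFin.
  by rewrite /F/= mul1r indicI -mulrA.
rewrite (@fubini_tonelli _ _ (measurableTypeR R) (measurableTypeR R) R
  lebesgue_measure lebesgue_measure (fun zs => (F zs)%:E))//=.
rewrite (integral_mulr_indic _ B) (integral_mulr_indic _ C).
have mbeta : measurable_fun [set: R] (fun p => beta_kernel a p * \1_B p).
  by apply: measurable_funM; [exact: measurable_beta_kernel|exact: measurable_indic].
have mgam : measurable_fun [set: R] (fun s => gamma_kernel (a + 2^-1) s * \1_C s).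
  by apply: measurable_funM; [exact: measurable_gamma_kernel|exact: measurable_indic].
rewrite -[in RHS]ge0_integralZl//=; last 3 first.
- exact/measurable_EFinP.
- by move=> s _; rewrite lee_fin mulr_ge0 ?gamma_kernel_ge0.
- by apply: integral_ge0 => p _; rewrite lee_fin mulr_ge0 ?beta_kernel_ge0.
rewrite -ge0_integralZl//=; last 3 first.
- by apply: emeasurable_funM => //; exact/measurable_EFinP.
- move=> s _; rewrite mule_ge0 ?lee_fin ?mulr_ge0 ?gamma_kernel_ge0//.
  by apply: integral_ge0 => p _; rewrite lee_fin mulr_ge0 ?beta_kernel_ge0.
- by rewrite lee_fin normal_peak_ge0.
apply: eq_integral => s _.
have mFs : measurable_fun [set: R] (fun z : R => (F (z, s))%:E).
  apply: (@measurableT_comp _ _ _ _ _ _ (fun zs => (F zs)%:E) _ (fun z => (z, s))).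
    exact: mF.
  exact: measurable_fun_pair.
(* Both sides vanish for s <= 0, where s - z^2 <= 0. *)
have [s0|s0] := ltP 0 s; last first.
  rewrite [in RHS]/gamma_kernel ltNge s0/= mul0r !mule0.
  apply: integral0_eq => z _; rewrite /F/= /gamma_kernel ltNge.
  by rewrite subr_le0 (le_trans s0 (sqr_ge0 z))/= !(mulr0, mul0r).
(* z = sqrt s * p *)
rewrite (@ge0_integral_affine _ (Num.sqrt s) 0) ?sqrtr_gt0//.
rewrite (muleC (integral _ _ _)) muleA -EFinM -!ge0_integralZl//=.
- apply: eq_integral => p _; rewrite -!EFinM; congr EFin; rewrite /F/= addr0.
  have -> : Num.sqrt s * p / Num.sqrt s = p.
    by rewrite mulrAC divff ?mul1r// gt_eqF// sqrtr_gt0.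
  rewrite [LHS](_ : _ = Num.sqrt s * (normal_pdf 0 1 (Num.sqrt s * p) *
    gamma_kernel a (s - (Num.sqrt s * p) ^+ 2)) * (\1_B p * \1_C s)); last ring.
  rewrite scaled_normal_gamma_density//; ring.
- exact/measurable_EFinP.
- by move=> p _; rewrite lee_fin mulr_ge0 ?beta_kernel_ge0.
- by rewrite lee_fin !mulr_ge0 ?normal_peak_ge0 ?gamma_kernel_ge0.
- apply: (@measurableT_comp _ _ _ _ _ _ (fun z : R => (F (z, s))%:E)) => //.
  by apply: measurable_funD => //; exact: mulrl_measurable.
Qed.

Lemma pos_fin_factor (R : realType) (k : R) (x y : \bar R) : 0 < k ->
  (0 <= x)%E -> (0 <= y)%E -> (1 = k%:E * (x * y))%E ->
  exists2 r, 0 < r & x = r%:E.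
Proof.
move=> k0; rewrite le_eqVlt => /predU1P[<- _|x0 y0].
  by rewrite mul0e mule0 => /eqP; rewrite eqe oner_eq0.
case: x x0 => [r||]// r0; first by move=> _; exists r.
move: y0; rewrite le_eqVlt => /predU1P[<-|y0].
  by rewrite !mule0 => /eqP; rewrite eqe oner_eq0.
by rewrite gt0_mulye// gt0_muley ?lte_fin.
Qed.

(** Applied to the whole space, [normal_gamma_integral] says that the masses [x]
    of the beta kernel and [y] of the new gamma kernel satisfy
    [k * normal_peak 1 * (x * y) = 1], with [k] the inverse of the mass of the
    kernel of shape [a]; hence they are finite and positive, and the constant in
    front of the joint law is exactly [x^-1 * y^-1]. *)
Lemma normal_gamma_law (R : realType) (a : R) :
  normalized_law (gamma_kernel a) setT = 1%E ->
  [/\ normalized_law (beta_kernel a) setT = 1%E,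
      normalized_law (gamma_kernel (a + 2^-1)) setT = 1%E &
      forall B C : set R, measurable B -> measurable C ->
        (\int[lebesgue_measure]_z ((normal_pdf 0 1 z)%:E *
           normalized_law (gamma_kernel a)
             ((fun t : R => z / Num.sqrt (z ^+ 2 + t))%R @^-1` B `&`
              (fun t : R => z ^+ 2 + t)%R @^-1` C)) =
         normalized_law (beta_kernel a) B *
         normalized_law (gamma_kernel (a + 2^-1)) C)%E].
Proof.
move=> gT.
set k := (fine (\int[lebesgue_measure]_x (gamma_kernel a x)%:E))^-1.
have k0 : 0 <= k.
  rewrite invr_ge0 fine_ge0// integral_ge0// => x _.
  by rewrite lee_fin gamma_kernel_ge0.
have kpeak : 0 < k * normal_peak 1.
  rewrite mulr_gt0 ?normal_peak_gt0 ?oner_eq0// lt_neqAle k0 andbT.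
  apply/eqP => k0'; move: gT; rewrite /normalized_law -/k -k0' mul0e => /eqP.
  by rewrite eqe eq_sym oner_eq0.
pose X (B : set R) := (\int[lebesgue_measure]_(p in B) (beta_kernel a p)%:E)%E.
pose Y (C : set R) :=
  (\int[lebesgue_measure]_(s in C) (gamma_kernel (a + 2^-1) s)%:E)%E.
have X0 B : (0 <= X B)%E.
  by apply: integral_ge0 => x _; rewrite lee_fin beta_kernel_ge0.
have Y0 C : (0 <= Y C)%E.
  by apply: integral_ge0 => x _; rewrite lee_fin gamma_kernel_ge0.
have joint (B C : set R) : measurable B -> measurable C ->
    (\int[lebesgue_measure]_z ((normal_pdf 0 1 z)%:E *
       normalized_law (gamma_kernel a)
         ((fun t : R => z / Num.sqrt (z ^+ 2 + t))%R @^-1` B `&`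
          (fun t : R => z ^+ 2 + t)%R @^-1` C)) =
     (k * normal_peak 1)%:E *
     (X B * Y C))%E.
  move=> mB mC; rewrite EFinM -muleA -normal_gamma_integral// -ge0_integralZl//=.
  - by apply: eq_integral => z _; rewrite /normalized_law muleCA.
  - apply: emeasurable_funM.
      by apply/measurable_EFinP; exact: measurable_normal_pdf.
    pose D (z t : R) : R :=
      \1_B (z / Num.sqrt (z ^+ 2 + t)) * \1_C (z ^+ 2 + t).
    under eq_fun do rewrite integral_mulr_indic indicI.
    apply: (@measurable_fun_fubini_tonelli_F _ _ R (measurableTypeR R) R
      lebesgue_measure
      (fun zt => (gamma_kernel a zt.2 * D zt.1 zt.2)%:E)) => /=; last first.
      by move=> zt; rewrite lee_fin !mulr_ge0 ?gamma_kernel_ge0.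
    have mS : measurable_fun [set: R * R] (fun zt : R * R => zt.1 ^+ 2 + zt.2).
      by apply: measurable_funD => //; exact: measurable_funX.
    apply/measurable_EFinP; apply: measurable_funM.
      by apply: measurableT_comp => //; exact: measurable_gamma_kernel.
    apply: measurable_funM.
      apply: (@measurableT_comp _ _ _ _ _ _ (\1_B : R -> R)).
        exact: measurable_indic.
      exact: measurable_fun_div_sqrt.
    by apply: (@measurableT_comp _ _ _ _ _ _ (\1_C : R -> R)).
  - move=> z _; rewrite mule_ge0 ?lee_fin ?normal_pdf_ge0//.
    by apply: integral_ge0 => x _; rewrite lee_fin gamma_kernel_ge0.
have := joint setT setT measurableT measurableT.
under eq_integral do rewrite !preimage_setT setTI gT mule1.
rewrite integral_normal_pdf.
move=> KXY.
have [x x0 Xx] : exists2 x, 0 < x & X setT = x%:E.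
  exact: (pos_fin_factor kpeak (X0 _) (Y0 _) KXY).
have [y y0 Yy] : exists2 y, 0 < y & Y setT = y%:E.
  apply: (pos_fin_factor kpeak (Y0 _) (X0 setT)).
  by rewrite KXY muleC (muleC (X _)) muleC.
have Kxy : k * normal_peak 1 = x^-1 * y^-1.
  move: KXY; rewrite Xx Yy -!EFinM => -[/esym Kxy].
  have xy0 : x * y != 0 by rewrite gt_eqF// mulr_gt0.
  by rewrite -[LHS](mulfK xy0) Kxy mul1r invfM.
have XE B : normalized_law (beta_kernel a) B = (x^-1%:E * X B)%E.
  by rewrite /normalized_law -/(X setT) Xx.
have YE C : normalized_law (gamma_kernel (a + 2^-1)) C = (y^-1%:E * Y C)%E.
  by rewrite /normalized_law -/(Y setT) Yy.
split.
- by rewrite XE Xx -EFinM mulVf// gt_eqF.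
- by rewrite YE Yy -EFinM mulVf// gt_eqF.
- by move=> B C mB mC; rewrite joint// XE YE Kxy EFinM muleACA.
Qed.

(** The Radon-Nikodym derivative of the normal law is almost everywhere its
    density. *)
Lemma ge0_integral_normal_prob (R : realType) (f : R -> \bar R) :
  measurable_fun [set: R] f -> (forall x, 0 <= f x)%E ->
  (\int[normal_prob 0 1]_x f x =
   \int[lebesgue_measure]_x ((normal_pdf 0 1 x)%:E * f x))%E.
Proof.
move=> mf f0; have Nmu := normal_prob_dominates (0 : R) 1.
rewrite -(Radon_Nikodym_SigmaFinite.change_of_variables Nmu f0 measurableT mf).
under [RHS]eq_integral do rewrite muleC.
have mdens := measurable_int _ (Radon_Nikodym_SigmaFinite.f_integrable Nmu).
have mpdf : measurable_fun [set: R] (fun x : R => (normal_pdf 0 1 x)%:E).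
  by apply/measurable_EFinP; exact: measurable_normal_pdf.
apply: ae_eq_integral => //; [exact: emeasurable_funM..|].
apply: ae_eqe_mul2l; apply: integral_ae_eq => //.
  exact: Radon_Nikodym_SigmaFinite.f_integrable.
by move=> A _ mA; rewrite -Radon_Nikodym_SigmaFinite.f_integral.
Qed.

(** Independence of [X] and [Y] conditionally on an event extends from rectangles
    to all measurable sets of the product: after division by [Pr E] both sides
    are measures that agree on rectangles. *)
Lemma product_law_on_event d d1 d2 (Omega : measurableType d)
    (T1 : measurableType d1) (T2 : measurableType d2) (R : realType)
    (Pr : probability Omega R) (m1 : probability T1 R) (m2 : probability T2 R)
    (E : set Omega) (X : Omega -> T1) (Y : Omega -> T2) (D : set (T1 * T2)) :
  measurable E -> measurable_fun setT X -> measurable_fun setT Y ->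
  (forall A B, measurable A -> measurable B ->
    Pr (E `&` (X @^-1` A `&` Y @^-1` B)) = (Pr E * (m1 A * m2 B))%E) ->
  measurable D ->
  Pr (E `&` (fun w => (X w, Y w)) @^-1` D) = (Pr E * (m1 \x m2) D)%E.
Proof.
move=> mE mX mY XY mD.
have mXY : measurable_fun setT (fun w => (X w, Y w)) by exact: measurable_fun_pair.
have mpre (A : set (T1 * T2)) : measurable A ->
    measurable ((fun w => (X w, Y w)) @^-1` A).
  by move=> mA; rewrite -[X in measurable X]setTI; exact: mXY.
have [e PE] : exists e : {nonneg R}, Pr E = e%:num%:E.
  have Efin : Pr E \is a fin_num by exact: fin_num_measure.
  have e0 : 0 <= fine (Pr E) by rewrite fine_ge0 ?measure_ge0.
  by exists (NngNum e0); rewrite /= fineK.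
(* A null event carries no mass on either side, and cannot be divided by. *)
have [e0|e0] := eqVneq (e%:num) 0.
  have PE0 : Pr E = 0%E by rewrite PE e0.
  rewrite PE0 mul0e; apply/eqP; rewrite eq_le measure_ge0 andbT -PE0.
  apply: le_measure; [rewrite inE|rewrite inE|exact: subIsetl] => //.
  by apply: measurableI => //; exact: mpre.
have einv0 : 0 <= e%:num^-1 by rewrite invr_ge0.
rewrite (@product_measure_unique _ _ T1 T2 R m1 m2
  (mscale (NngNum einv0) (pushforward (mrestr Pr mE) (fun w => (X w, Y w)))))//=.
  by rewrite /mscale/= /pushforward /mrestr PE muleA -EFinM divff// mul1e setIC.
move=> A B mA mB; rewrite /mscale/= /pushforward /mrestr setIC.
rewrite (_ : _ @^-1` _ = X @^-1` A `&` Y @^-1` B)// XY// PE.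
by rewrite muleA -EFinM mulVf// mul1e.
Qed.

(** The form in which the beta-gamma identity is iterated: the event [E] collects
    the conditions on the other coordinates, whether already replaced by ratios
    or not. *)
Lemma normal_gamma_event d (Omega : measurableType d) (R : realType)
    (Pr : probability Omega R) (a : R) (E : set Omega) (X T : Omega -> R) :
  measurable E -> measurable_fun [set: Omega] X -> measurable_fun [set: Omega] T ->
  (forall C, measurable C -> Pr (T @^-1` C) = normalized_law (gamma_kernel a) C) ->
  (forall A C, measurable A -> measurable C ->
    Pr (E `&` (X @^-1` A `&` T @^-1` C)) =
    (Pr E * (normal_prob 0 1 A * normalized_law (gamma_kernel a) C))%E) ->
  forall B C, measurable B -> measurable C ->
    Pr (E `&` ((fun w => X w / Num.sqrt (X w ^+ 2 + T w)) @^-1` B `&`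
               (fun w => X w ^+ 2 + T w) @^-1` C)) =
    (Pr E * (normalized_law (beta_kernel a) B *
             normalized_law (gamma_kernel (a + 2^-1)) C))%E.
Proof.
move=> mE mX mT lawT indep B C mB mC.
pose mT_mixin := isMeasurableFun.Build _ _ _ _ _ mT.
pose T' : {RV Pr >-> R} := HB.pack T mT_mixin.
pose D : set (R * R) :=
  (fun zt => zt.1 / Num.sqrt (zt.1 ^+ 2 + zt.2)) @^-1` B `&`
  (fun zt => zt.1 ^+ 2 + zt.2) @^-1` C.
have mS : measurable_fun [set: R * R] (fun zt : R * R => zt.1 ^+ 2 + zt.2).
  by apply: measurable_funD => //; exact: measurable_funX.
have mD : measurable D.
  apply: measurableI; rewrite -[X in measurable X]setTI; last exact: mS.
  by apply: measurable_fun_div_sqrt.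
have [|_ _ /(_ B C mB mC) <-] := @normal_gamma_law R a.
  by rewrite -lawT// preimage_setT probability_setT.
have PE := @product_law_on_event _ _ _ Omega (measurableTypeR R) R R Pr
  (normal_prob 0 1)
  (distribution Pr T') E X T D mE mX mT.
rewrite -[LHS]/(Pr (E `&` (fun w => (X w, T w)) @^-1` D)) PE//; last first.
  by move=> A F mA mF; rewrite indep// -lawT.
congr (_ * _)%E.
rewrite /product_measure1 ge0_integral_normal_prob//=; last first.
  exact: measurable_fun_xsection.
apply: eq_integral => z _; congr (_ * _)%E.
rewrite -lawT.
  by rewrite /distribution /pushforward xsectionE.
by have := measurable_xsection z mD; rewrite xsectionE.
Qed.

(** * Independence within a row *)

Section tail_sums.
Context (T : Type) (R : realType) (i : nat) (X : nat -> T -> R) (Y : T -> R).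

(** [tail_sum] and [tail_ratio] are [Tsum] and [Pcor] for a single row, on an
    arbitrary base: it is the sample space for the laws and the space of values
    of [(Z_i, G_i)] for measurability. *)
Definition tail_sum (j : nat) (w : T) : R :=
  \sum_(j.+1 <= k < i) X k w ^+ 2 + Y w.

Definition tail_ratio (j : nat) (w : T) : R :=
  X j w / Num.sqrt (X j w ^+ 2 + tail_sum j w).

Lemma tail_sumS j w : (j.+1 < i)%N ->
  tail_sum j w = X j.+1 w ^+ 2 + tail_sum j.+1 w.
Proof. by move=> ji; rewrite /tail_sum big_ltn// addrA. Qed.

End tail_sums.

Section row.
Context d (Omega : measurableType d) (R : realType) (Pr : probability Omega R).
Variables (i : nat) (X : nat -> Omega -> R) (Y : Omega -> R) (b : nat -> R).
Hypothesis mX : forall k, measurable_fun [set: Omega] (X k).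
Hypothesis mY : measurable_fun [set: Omega] Y.

Local Notation tail_sum := (tail_sum i X Y).
Local Notation tail_ratio := (tail_ratio i X Y).

Lemma measurable_tail_sum j : measurable_fun [set: Omega] (tail_sum j).
Proof.
apply: measurable_funD => //; apply: measurable_sum => k.
exact: measurable_funX.
Qed.

Lemma measurable_tail_ratio j : measurable_fun [set: Omega] (tail_ratio j).
Proof.
apply: measurable_fun_div_sqrt => //.
by apply: measurable_funD; [exact: measurable_funX|exact: measurable_tail_sum].
Qed.

Hypothesis i_gt0 : (0 < i)%N.
Hypothesis bS : forall j, (0 < j < i)%N -> b j.-1 = b j + 2^-1.
Hypothesis indepXY : forall (A : nat -> set R) C,
  (forall k, measurable (A k)) -> measurable C ->
  Pr (\bigcap_(k in [set k | (1 <= k < i)%N]) (X k @^-1` A k) `&` Y @^-1` C) =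
  (\prod_(1 <= k < i) normal_prob 0 1 (A k) *
   normalized_law (gamma_kernel (b i.-1)) C)%E.

Let mixed (j k : nat) := if (k <= j)%N then X k else tail_ratio k.
Let mixed_law (j k : nat) : set R -> \bar R :=
  if (k <= j)%N then normal_prob 0 1 else normalized_law (beta_kernel (b k)).
Let D : set nat := [set k | (1 <= k < i)%N].

Let mmixed j k (A : set R) : measurable A -> measurable (mixed j k @^-1` A).
Proof.
move=> mA; rewrite /mixed -[X in measurable X]setTI.
by case: ifP => _; [exact: mX|exact: measurable_tail_ratio].
Qed.

(** The state after the coordinates of index larger than [j] have been replaced
    by ratios.  The total masses are part of it because they are what allows
    marginals to be read off the joint law. *)
Let mixed_step (j : nat) : Prop :=
  [/\ forall (A : nat -> set R) C,
        (forall k, measurable (A k)) -> measurable C ->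
        Pr (\bigcap_(k in D) (mixed j k @^-1` A k) `&` tail_sum j @^-1` C) =
        (\prod_(1 <= k < i) mixed_law j k (A k) *
         normalized_law (gamma_kernel (b j)) C)%E,
      normalized_law (gamma_kernel (b j)) setT = 1%E &
      forall k, (j < k < i)%N -> normalized_law (beta_kernel (b k)) setT = 1%E].

Let mixed_lawT j k : mixed_step j -> (1 <= k < i)%N -> mixed_law j k setT = 1%E.
Proof.
move=> [_ _ betaT] /andP[k1 ki]; rewrite /mixed_law; case: ifPn => kj.
  exact: probability_setT.
by apply: betaT; rewrite ltnNge kj ki.
Qed.

Let mixed_step_base : mixed_step i.-1.
Proof.
have joint (A : nat -> set R) C :
    (forall k, measurable (A k)) -> measurable C ->
    Pr (\bigcap_(k in D) (mixed i.-1 k @^-1` A k) `&` tail_sum i.-1 @^-1` C) =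
    (\prod_(1 <= k < i) mixed_law i.-1 k (A k) *
     normalized_law (gamma_kernel (b i.-1)) C)%E.
  move=> mA mC.
  rewrite (_ : \bigcap_(k in D) _ = \bigcap_(k in D) (X k @^-1` A k)); last first.
    apply: eq_bigcapr => k /andP[k1 ki].
    by rewrite /mixed -ltnS prednK// ki.
  rewrite (_ : tail_sum i.-1 = Y); last first.
    by apply/funext => w; rewrite /tail_sum prednK// big_geq// add0r.
  rewrite indepXY//; congr (_ * _)%E.
  apply: eq_big_nat => k /andP[k1 ki].
  by rewrite /mixed_law -ltnS prednK// ki.
split => //.
  have := joint (fun=> setT) setT (fun=> measurableT) measurableT.
  rewrite preimage_setT setIT bigcapT// probability_setT.
  rewrite big_nat_cond big1 ?mul1e// => k; rewrite andbT => /andP[k1 ki].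
  by rewrite /mixed_law -ltnS prednK// ki; exact: probability_setT.
by move=> k /andP[]; rewrite prednK// leqNgt => /negPf ->.
Qed.

Let mixed_step_pred j : (j.+1 < i)%N -> mixed_step j.+1 -> mixed_step j.
Proof.
move=> ji st; have [joint gammaT betaT] := st.
have bj : b j = b j.+1 + 2^-1 by rewrite -bS.
have [betajT gammajT _] := normal_gamma_law gammaT.
split; [|by rewrite bj|]; last first.
  move=> k /andP[jk ki]; have [->//|kj] := eqVneq k j.+1.
  by apply: betaT; rewrite ki andbT ltn_neqAle eq_sym kj.
move=> A C mA mC.
have Dj : D j.+1 by rewrite /D/=.
pose E := \bigcap_(k in D `\ j.+1) (mixed j.+1 k @^-1` A k).
pose c := (\prod_(1 <= k < i | k != j.+1) mixed_law j.+1 k (A k))%E.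
have mE : measurable E.
  by apply: bigcap_measurableType => k _; exact: mmixed.
(* Only the set at index j.+1 varies; the other coordinates form E. *)
have joint_split (B C' : set R) : measurable B -> measurable C' ->
    Pr (E `&` (X j.+1 @^-1` B `&` tail_sum j.+1 @^-1` C')) =
    (c * (normal_prob 0 1 B * normalized_law (gamma_kernel (b j.+1)) C'))%E.
  move=> mB mC'; pose A' k := if k == j.+1 then B else A k.
  have mA' k : measurable (A' k) by rewrite /A'; case: ifP.
  have := joint A' C' mA' mC'.
  rewrite (bigcap_setD1 j.+1)// (bigD1_seq j.+1)/= ?mem_index_iota ?iota_uniq//.
  have -> : A' j.+1 = B by rewrite /A' eqxx.
  rewrite {1}/mixed {1}/mixed_law leqnn.
  rewrite (_ : \bigcap_(k in D `\ j.+1) _ = E); last first.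
    by apply: eq_bigcapr => k [_ /eqP/negPf kj]; rewrite /A' kj.
  rewrite (_ : \big[_/_]_(_ <- _ | _) _ = c); last first.
    by apply: eq_bigr => k /negPf kj; rewrite /A' kj.
  by rewrite (setIC _ E) -setIA muleAC (muleC _ c) => <-.
(* Taking the whole line for both sets identifies the constant. *)
have PE : Pr E = c.
  have := joint_split setT setT measurableT measurableT.
  by rewrite !preimage_setT !setIT gammaT [normal_prob _ _ _]probability_setT !mule1.
have lawT C' : measurable C' ->
    Pr (tail_sum j.+1 @^-1` C') = normalized_law (gamma_kernel (b j.+1)) C'.
  move=> mC'; have := joint (fun=> setT) C' (fun=> measurableT) mC'.
  rewrite bigcapT ?setTI// big_nat_cond big1 ?mul1e// => k.
  by rewrite andbT => kD; exact: mixed_lawT.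
rewrite (bigcap_setD1 j.+1)// (bigD1_seq j.+1)/= ?mem_index_iota ?iota_uniq//.
rewrite {1}/mixed {1}/mixed_law ltnn.
rewrite (_ : \bigcap_(k in D `\ j.+1) _ = E); last first.
  apply: eq_bigcapr => k [_ /eqP kj].
  by rewrite /mixed (leq_eqVlt k j.+1) (negPf kj).
rewrite (_ : \big[_/_]_(_ <- _ | _) _ = c); last first.
  by apply: eq_bigr => k kj; rewrite /mixed_law (leq_eqVlt k j.+1) (negPf kj).
rewrite (setIC _ E) -setIA -PE bj muleAC (muleC _ (Pr E)).
rewrite (_ : tail_sum j = (fun w => X j.+1 w ^+ 2 + tail_sum j.+1 w)); last first.
  by apply/funext => w; rewrite tail_sumS.
apply: normal_gamma_event => //; first exact: measurable_tail_sum.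
by move=> B C' mB mC'; rewrite joint_split// PE.
Qed.

Lemma tail_ratio_joint_law :
  (forall A : nat -> set R, (forall k, measurable (A k)) ->
    Pr (\bigcap_(k in [set k | (1 <= k < i)%N]) (tail_ratio k @^-1` A k)) =
    (\prod_(1 <= k < i) normalized_law (beta_kernel (b k)) (A k))%E) /\
  (forall k, (1 <= k < i)%N -> normalized_law (beta_kernel (b k)) setT = 1%E).
Proof.
have step n : (n <= i.-1)%N -> mixed_step (i.-1 - n).
  elim: n => [_|n IH ni]; first by rewrite subn0; exact: mixed_step_base.
  apply: mixed_step_pred; rewrite subnSK//; last exact: IH (ltnW ni).
  by rewrite -[ltnRHS]prednK// ltnS leq_subr.
have := step i.-1 (leqnn _); rewrite subnn => -[joint gammaT betaT].
split => // A mA; have := joint A setT mA measurableT.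
rewrite preimage_setT setIT gammaT mule1.
rewrite (_ : \bigcap_(k in D) _ =
    \bigcap_(k in D) (tail_ratio k @^-1` A k)); last first.
  by apply: eq_bigcapr => k /andP[k1 _]; rewrite /mixed leqNgt k1.
move=> ->; apply: eq_big_nat => k /andP[k1 _].
by rewrite /mixed_law leqNgt k1.
Qed.

End row.

(** * The telescoping products *)

Section pathwise.
Context (T : Type) (R : realType) (i : nat) (X : nat -> T -> R) (Y : T -> R).
Variables (w : T) (Y_gt0 : 0 < Y w).

Lemma tail_sum_gt0 j : 0 < tail_sum i X Y j w.
Proof. by rewrite ltr_wpDl// sumr_ge0// => k _; rewrite sqr_ge0. Qed.

Lemma one_sub_tail_ratio_sqr j : (j.+1 < i)%N ->
  1 - tail_ratio i X Y j.+1 w ^+ 2 =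
  tail_sum i X Y j.+1 w / tail_sum i X Y j w.
Proof.
move=> ji; have S0 := tail_sum_gt0 j.
rewrite /tail_ratio -tail_sumS// expr_div_n sqr_sqrtr ?ltW//.
rewrite -[X in X - _](divff (lt0r_neq0 S0)) -mulrBl; congr (_ / _).
by rewrite tail_sumS// addrAC subrr add0r.
Qed.

(** Each factor is [sqrt (T_k / T_(k-1))]. *)
Lemma prod_sqrt_tail_ratio j : (j < i)%N ->
  \prod_(1 <= k < j.+1) Num.sqrt (1 - tail_ratio i X Y k w ^+ 2) =
  Num.sqrt (tail_sum i X Y j w) / Num.sqrt (tail_sum i X Y 0 w).
Proof.
elim: j => [|j IH] ji.
  by rewrite big_geq// divff// gt_eqF// sqrtr_gt0 tail_sum_gt0.
rewrite big_nat_recr//= IH ?(ltnW ji)// one_sub_tail_ratio_sqr//.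
have S0 : Num.sqrt (tail_sum i X Y j w) != 0.
  by rewrite gt_eqF// sqrtr_gt0 tail_sum_gt0.
rewrite sqrtrM ?ltW ?tail_sum_gt0// sqrtrV ?ltW ?tail_sum_gt0//.
by rewrite mulrC mulrA divfK.
Qed.

Lemma tail_ratio_prod_sqrt j : (0 < j < i)%N ->
  tail_ratio i X Y j w *
    \prod_(1 <= k < j) Num.sqrt (1 - tail_ratio i X Y k w ^+ 2) =
  X j w / Num.sqrt (tail_sum i X Y 0 w).
Proof.
case: j => // j /= ji; rewrite prod_sqrt_tail_ratio ?(ltnW ji)//.
rewrite /tail_ratio -tail_sumS// mulrA divfK//.
by rewrite gt_eqF// sqrtr_gt0 tail_sum_gt0.
Qed.

End pathwise.

(** * Mutual independence *)

Section independence.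
Context d (Omega : measurableType d) (R : realType) (Pr : probability Omega R).

Lemma mutually_independentS (I : choiceType) (D : set I)
    (F F' : I -> set_system Omega) :
  (forall i, D i -> F' i `<=` F i) ->
  mutually_independent Pr D F -> mutually_independent Pr D F'.
Proof.
move=> F'F [mF indF]; split=> [i Di|J E JE].
  exact: subset_trans (F'F i Di) (mF i Di).
by apply: indF => i iJ; have [Di EF'] := JE i iJ; split => //; exact: F'F.
Qed.

Lemma g_sigma_algebra_preimage_measurable d' (T : measurableType d')
    (f : Omega -> T) : measurable_fun setT f ->
  g_sigma_algebra_preimage f `<=` measurable.
Proof. by move=> mf A [B mB <-]; apply: mf. Qed.

Lemma bigcap_g_sigma_algebra_preimage d' (T : measurableType d')
    (f : Omega -> T) (I : choiceType) (J : {fset I}) (E : I -> set Omega) :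
  (forall i, i \in J -> g_sigma_algebra_preimage f (E i)) ->
  g_sigma_algebra_preimage f (\bigcap_(i in [set` J]) E i).
Proof.
move=> JE.
rewrite -[g_sigma_algebra_preimage f _]/(measurable
  (\bigcap_(i in [set` J]) E i : set (g_sigma_algebra_preimageType f))).
exact: fin_bigcap_measurable.
Qed.

(** The product formula over the full interval contains that of every subfamily:
    take the whole line at the indices left out. *)
Lemma mutually_independent_interval (n : nat) (X : nat -> Omega -> R) :
  (forall k, measurable_fun [set: Omega] (X k)) ->
  (forall A : nat -> set R, (forall k, measurable (A k)) ->
    Pr (\bigcap_(k in [set k | (1 <= k < n)%N]) (X k @^-1` A k)) =
    (\prod_(1 <= k < n) Pr (X k @^-1` A k))%E) ->
  mutually_independent Pr [set k | (1 <= k < n)%N]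
    (fun k => g_sigma_algebra_preimage (X k)).
Proof.
move=> mX prodX; split=> [k _|J E JE]; first exact: g_sigma_algebra_preimage_measurable.
have exB : forall k : nat, exists Bk : set R,
    measurable Bk /\ (if k \in J then X k @^-1` Bk = E k else Bk = setT).
  move=> k; case: (boolP (k \in J)) => kJ; last by exists setT.
  by have [_ [B mB <-]] := JE k kJ; exists B; rewrite setTI.
have [B BE] := choice exB.
have JD k : k \in J -> (1 <= k < n)%N by move=> /JE[].
have -> : \bigcap_(k in [set` J]) E k =
    \bigcap_(k in [set k | (1 <= k < n)%N]) (X k @^-1` B k).
  apply/seteqP; split => w Jw k kD.
    have [_] := BE k; case: ifPn => [kJ ->|_ ->//]; exact: Jw.
  by have [_] := BE k; rewrite kD => <-; apply: Jw; exact: JD.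
rewrite prodX; last by move=> k; have [] := BE k.
rewrite (bigID (mem J))/= [X in (_ * X)%E]big1 ?mule1; last first.
  move=> k /negPf kJ; have [_] := BE k; rewrite kJ => ->.
  by rewrite preimage_setT probability_setT.
rewrite -big_filter (perm_big (enum_fset J)); last first.
  apply: uniq_perm; rewrite ?filter_uniq ?iota_uniq ?fset_uniq// => k.
  by rewrite mem_filter mem_index_iota; apply/andP/idP => [[]//|kJ]; rewrite kJ JD.
by apply: eq_big_seq => k kJ; have [_] := BE k; rewrite (kJ : k \in J) => ->.
Qed.

Lemma mutually_independent_prod_interval (n : nat) (F : nat -> set_system Omega) :
  mutually_independent Pr [set k | (1 <= k < n)%N] F ->
  forall E, (forall k, (1 <= k < n)%N -> F k (E k)) ->
  Pr (\bigcap_(k in [set k | (1 <= k < n)%N]) E k) =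
  (\prod_(1 <= k < n) Pr (E k))%E.
Proof.
move=> [_ indF] E FE.
pose J := [fset k in index_iota 1 n]%fset.
have JE k : (k \in J) = (1 <= k < n)%N by rewrite in_fset/= mem_index_iota.
rewrite (perm_big (enum_fset J)); last first.
  apply: uniq_perm; rewrite ?iota_uniq ?fset_uniq// => k.
  by rewrite mem_index_iota -JE.
rewrite -indF; last by move=> k; rewrite JE => kD; split => //; exact: FE.
rewrite (_ : [set` J] = [set k | (1 <= k < n)%N])//.
by apply/seteqP; split => k /=; rewrite JE.
Qed.

(** Independent groups of independent families form one independent family: the
    events with index in the group [k] intersect in an event of the sigma-algebra
    generated by [f k]. *)
Lemma mutually_independent_grouped (I K : choiceType) (D : set I) (DK : set K)
    (h : I -> K) (F : I -> set_system Omega) (d' : K -> measure_display)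
    (T : forall k, measurableType (d' k)) (f : forall k, Omega -> T k) :
  (forall i, D i -> DK (h i)) ->
  (forall i, D i -> F i `<=` g_sigma_algebra_preimage (f (h i))) ->
  mutually_independent Pr DK (fun k => g_sigma_algebra_preimage (f k)) ->
  (forall k, DK k -> mutually_independent Pr [set i | D i /\ h i = k] F) ->
  mutually_independent Pr D F.
Proof.
move=> Dh Fh [mS indS] indF; split=> [i Di|J E JE].
  by apply: (subset_trans (Fh i Di)); exact: mS (Dh i Di).
pose E' k := \bigcap_(i in [set` [fset i in J | h i == k]%fset]) E i.
have -> : \bigcap_(i in [set` J]) E i =
    \bigcap_(k in [set` [fset h i | i in J]%fset]) E' k.
  apply/seteqP; split => w Jw.
    by move=> k _ i /=; rewrite !inE => /andP[iJ _]; exact: Jw.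
  by move=> i /= iJ; apply: (Jw (h i)); rewrite /= ?in_imfset// !inE iJ/=.
rewrite indS; last first.
  move=> _ /imfsetP[i /= iJ ->]; split; first by apply: Dh; have [] := JE i iJ.
  apply: bigcap_g_sigma_algebra_preimage => i'.
  rewrite !inE => /andP[i'J /eqP <-]; have [Di' FE] := JE i' i'J.
  exact: Fh.
rewrite [RHS](partition_big_imfset _ h)/=.
apply: eq_big_seq => _ /imfsetP[i /= iJ ->].
rewrite big_fset_condE /E' (indF (h i) _).2//.
- by apply: Dh; have [] := JE i iJ.
- by move=> i'; rewrite !inE => /andP[i'J /eqP]; have [] := JE i' i'J.
Qed.

End independence.

Lemma mutually_independent_subsingleton d (Omega : measurableType d)
    (R : realType) (Pr : probability Omega R) (I : choiceType) (D : set I)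
    (F : I -> set_system Omega) :
  (forall i, D i -> F i `<=` measurable) ->
  (forall i i', D i -> D i' -> i = i') ->
  mutually_independent Pr D F.
Proof.
move=> mF Deq; split => // J E JE.
have [->|[i iJ]] := fset_0Vmem J.
  rewrite big_seq_fset0 (_ : [set` _] = set0) ?bigcap_set0 ?probability_setT//.
  by apply/seteqP; split => k.
have -> : J = [fset i]%fset.
  apply/fsetP => k; rewrite inE; apply/idP/eqP => [kJ|->//].
  by apply: Deq; [have [] := JE k kJ|have [] := JE i iJ].
by rewrite big_seq_fset1 set_fset1 bigcap_set1.
Qed.

Lemma measurable_vcoord (R : realType) (m j : nat) :
  measurable_fun setT (fun v : m.-tuple R => vcoord v j).
Proof.
have [jm|mj] := ltnP j.-1 m; last first.
  rewrite (_ : (fun v => _) = cst 0); first exact: measurable_cst.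
  by apply/funext => v; rewrite /vcoord nth_default// size_tuple.
rewrite (_ : (fun v => _) = (fun v => tnth v (Ordinal jm))); last first.
  by apply/funext => v; rewrite /vcoord (tnth_nth 0).
exact: measurable_tnth.
Qed.

(** * The laws of one row *)

Section bartlett_row_law.
Context d (Omega : measurableType d) (R : realType) (Pr : probability Omega R).
Variables (n i : nat) (eta : R).
Variables (Z : {RV Pr >-> i.-1.-tuple R}) (G : {RV Pr >-> R}).
Hypothesis i_gt0 : (0 < i)%N.
Hypothesis hZ : std_normal_vector Pr Z.
Hypothesis hG : has_law Pr G (chi2_law (n%:R + 2 * eta - i%:R)).
Hypothesis hZG : independent2 Pr Z G.

Let X (k : nat) (w : Omega) : R := vcoord (Z w) k.

Let mX k : measurable_fun [set: Omega] (X k).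
Proof. exact: (measurableT_comp (@measurable_vcoord R i.-1 k)). Qed.

(** The shape [beta_par n eta i.-1] is half of [n + 2 eta - i], the number of
    degrees of freedom of [G]. *)
Let normal_chi2_joint (A : nat -> set R) (C : set R) :
  (forall k, measurable (A k)) -> measurable C ->
  Pr (\bigcap_(k in [set k | (1 <= k < i)%N]) (X k @^-1` A k) `&` G @^-1` C) =
  (\prod_(1 <= k < i) normal_prob 0 1 (A k) *
   normalized_law (gamma_kernel (beta_par n eta i.-1)) C)%E.
Proof.
move=> mA mC; have [indZ lawZ] := hZ.
have le_pred k : (k <= i.-1)%N = (k < i)%N by rewrite -ltnS prednK.
pose B : set (i.-1.-tuple R) :=
  \bigcap_(k in [set k | (1 <= k < i)%N]) ((fun v => vcoord v k) @^-1` A k).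
have mB : measurable B.
  apply: bigcap_measurableType => k _; rewrite -[X in measurable X]setTI.
  exact: measurable_vcoord.
rewrite -[X in Pr (X `&` _)]/(Z @^-1` B) hZG//; congr (_ * _)%E.
  rewrite -[X in Pr X]/(\bigcap_(k in [set k | (1 <= k < i)%N]) (X k @^-1` A k)).
  rewrite (_ : [set k | (1 <= k <= i.-1)%N] =
      [set k | (1 <= k < i)%N]) in indZ; last first.
    by apply/seteqP; split => k /=; rewrite le_pred.
  rewrite (mutually_independent_prod_interval indZ); last first.
    by move=> k _; exists (A k) => //; rewrite setTI.
  apply: eq_big_nat => k ki; have [|_ <-] := lawZ k => //.
  by rewrite le_pred.
have [_ lawG] := hG; rewrite [LHS]lawG// /chi2_law.
rewrite (_ : _ / 2 = beta_par n eta i.-1) ?gamma_law2E//.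
by rewrite /beta_par -subn1 natrB//; field.
Qed.

Lemma bartlett_row_law :
  mutually_independent Pr [set j | (1 <= j < i)%N]
    (fun j => g_sigma_algebra_preimage (tail_ratio i X G j)) /\
  (forall j, (1 <= j < i)%N ->
    has_law Pr (tail_ratio i X G j) (cvine_tree_law n eta j)).
Proof.
have bS j : (0 < j < i)%N ->
    beta_par n eta j.-1 = beta_par n eta j + 2^-1.
  by move=> /andP[j0 _]; rewrite /beta_par -subn1 natrB//; field.
have mG : measurable_fun [set: Omega] G by [].
have [joint lawT] := tail_ratio_joint_law mX mG i_gt0 bS normal_chi2_joint.
have mP j := measurable_tail_ratio i mX mG j.
have law j B : (1 <= j < i)%N -> measurable B ->
    Pr (tail_ratio i X G j @^-1` B) =
    normalized_law (beta_kernel (beta_par n eta j)) B.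
  move=> ji mB; pose A k := if k == j then B else setT.
  have mA k : measurable (A k) by rewrite /A; case: ifP.
  have Aj : A j = B by rewrite /A eqxx.
  have AT k : k != j -> A k = setT by rewrite /A => /negPf ->.
  have := joint A mA.
  rewrite (bigcap_setD1 j)// bigcapT ?setIT; last first.
    by move=> k [_ /eqP kj]; rewrite AT// preimage_setT.
  rewrite Aj => ->.
  rewrite (bigD1_seq j)/= ?mem_index_iota ?iota_uniq// Aj.
  rewrite big_nat_cond big1 ?mule1// => k /andP[ki kj].
  by rewrite AT// lawT.
split.
  apply: mutually_independent_interval => // A mA; rewrite joint//.
  by apply: eq_big_nat => k ki; rewrite law.
move=> j ji; split => // B mB.
by rewrite cvine_tree_lawE// -law.
Qed.

End bartlett_row_law.

(** * The coupling of all rows *)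

Lemma chi2_law_gt0_ae d (Omega : measurableType d) (R : realType)
    (Pr : probability Omega R) (G : Omega -> R) (a : R) :
  has_law Pr G (chi2_law a) -> {ae Pr, forall w, 0 < G w}.
Proof.
move=> [mG lawG]; exists (G @^-1` `]-oo, 0]); split.
- by rewrite -[X in measurable X]setTI; exact: mG.
- rewrite [LHS](lawG `]-oo, 0]%classic)// /chi2_law /gamma_law.
  apply: integral0_eq => x /=; rewrite in_itv/= /gamma_pdf => x0.
  by rewrite ltNge x0.
- by move=> w /= /negP; rewrite -leNgt in_itv.
Qed.

Lemma measurable_tuple d (T : measurableType d) (R : realType) (m : nat)
    (f : nat -> T -> R) : (forall k, measurable_fun [set: T] (f k)) ->
  measurable_fun [set: T] (fun x => [tuple f k x | k < m]).
Proof.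
move=> mf; apply/measurable_fun_tnthP => k.
rewrite (_ : _ \o _ = f k)//.
by apply/funext => x /=; rewrite tnth_mktuple.
Qed.

Section bartlett_rows.
Context (R : realType) (i : nat).
Local Notation T := (i.-1.-tuple R * R)%type.

Let X (k : nat) (v : T) : R := vcoord v.1 k.
Let Y (v : T) : R := v.2.

Let mX k : measurable_fun [set: T] (X k).
Proof. exact: (measurableT_comp (@measurable_vcoord R i.-1 k)). Qed.

(** A row of the coupling depends on the realised rows only through
    [(z i, g i)].  The function is written with [tail_ratio], since [Pcor] takes a
    whole family of rows, which cannot be built from the single tuple [z i]
    without a cast. *)
Lemma measurable_bartlett_coupling :
  exists2 f : T -> i.-1.-tuple R * i.-tuple R, measurable_fun [set: T] f &
  forall (z : forall i : nat, i.-1.-tuple R) (g : nat -> R),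
    (Pcor_row z g i, bartlett_row z g i) = f (z i, g i).
Proof.
have mY : measurable_fun [set: T] Y by exact: measurable_snd.
have mdiv (h : T -> R) : measurable_fun [set: T] h ->
    measurable_fun [set: T] (fun v => h v / Num.sqrt (tail_sum i X Y 0 v)).
  by move=> mh; apply: measurable_fun_div_sqrt => //; exact: measurable_tail_sum.
pose entry (j : nat) (v : T) : R :=
  if (i < j)%N then 0
  else if (j < i)%N then X j v / Num.sqrt (tail_sum i X Y 0 v)
  else if i == 1%N then 1 else Num.sqrt (Y v) / Num.sqrt (tail_sum i X Y 0 v).
exists (fun v => ([tuple tail_ratio i X Y j.+1 v | j < i.-1],
                  [tuple entry j.+1 v | j < i])) => //.
apply: measurable_fun_pair.
  apply: (measurable_tuple (f := fun j => tail_ratio i X Y j.+1)) => k.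
  exact: measurable_tail_ratio.
apply: (measurable_tuple (f := fun j => entry j.+1)) => k.
rewrite /entry; case: (i < k.+1)%N; first exact: measurable_cst.
case: (k.+1 < i)%N; first exact: mdiv.
case: (i == 1%N); first exact: measurable_cst.
by apply: mdiv; apply: measurableT_comp mY; exact: measurable_sqrt.
Qed.

End bartlett_rows.

Theorem theorem2 (d : measure_display) (Omega : measurableType d)
    (R : realType) (Pr : probability Omega R) (n : nat) (eta : R)
    (Z : forall i : nat, {RV Pr >-> i.-1.-tuple R})
    (G : nat -> {RV Pr >-> R})
    (hn : (2 <= n)%N) (heta : 0 < eta)
    (hZ : forall i, (2 <= i <= n)%N -> std_normal_vector Pr (Z i))
    (hG : forall i, (2 <= i <= n)%N ->
      has_law Pr (G i) (chi2_law (n%:R + 2 * eta - i%:R)))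
    (hZG : forall i, (2 <= i <= n)%N -> independent2 Pr (Z i) (G i))
    (hrows : mutually_independent Pr [set i | 2 <= i <= n]%N
      (fun i => g_sigma_algebra_preimage (fun w => (Z i w, G i w)))) :
  let z := fun w i => Z i w in
  let g := fun w i => G i w in
  let P := fun i j w => Pcor (z w) (g w) i j in
  let L := fun i j w => bartlett_entry (z w) (g w) i j in
  (forall i, (2 <= i <= n)%N ->
     [/\ (* the two expressions of P_ij *)
         forall j w, (1 <= j < i)%N ->
           P i j w = vcoord (Z i w) j / Num.sqrt (Tsum (z w) (g w) i j.-1),
         (* (i) *)
         mutually_independent Pr [set j | 1 <= j < i]%N
             (fun j => g_sigma_algebra_preimage (P i j)) /\
           (forall j, (1 <= j < i)%N ->
             has_law Pr (P i j) (cvine_tree_law n eta j)) &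
         (* (ii) *)
         {ae Pr, forall w,
           (forall j, (1 <= j < i)%N ->
              P i j w * \prod_(1 <= k < j) Num.sqrt (1 - P i k w ^+ 2)
                = vcoord (Z i w) j / Snorm (z w) (g w) i /\
              vcoord (Z i w) j / Snorm (z w) (g w) i = L i j w) /\
           \prod_(1 <= k < i) Num.sqrt (1 - P i k w ^+ 2)
             = Num.sqrt (G i w) / Snorm (z w) (g w) i /\
           Num.sqrt (G i w) / Snorm (z w) (g w) i = L i i w}]) /\
  (* the couplings (P_i, L_i) are independent across rows *)
  mutually_independent Pr [set i | 2 <= i <= n]%N
    (fun i => g_sigma_algebra_preimage
      (fun w => (Pcor_row (z w) (g w) i, bartlett_row (z w) (g w) i))) /\
  cvine_input Pr n eta (fun j i => P i j) /\
  {ae Pr, forall w,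
    cvine_factor n (fun j i => P i j w) = bartlett_factor (z w) (g w) n}.
Proof.
move=> z g P L.
pose X i k w := vcoord (Z i w) k.
have i_gt0 i : (2 <= i <= n)%N -> (0 < i)%N by move=> /andP[/ltnW].
have mX i k : measurable_fun [set: Omega] (X i k).
  exact: (measurableT_comp (@measurable_vcoord R i.-1 k)).
have PE i : P i = tail_ratio i (X i) (G i) by [].
have mP i j : measurable_fun [set: Omega] (P i j).
  rewrite PE; exact: (measurable_tail_ratio i (mX i) _ j).
have row i (hi : (2 <= i <= n)%N) :
    mutually_independent Pr [set j | (1 <= j < i)%N]
      (fun j => g_sigma_algebra_preimage (P i j)) /\
    (forall j, (1 <= j < i)%N -> has_law Pr (P i j) (cvine_tree_law n eta j)).
  rewrite PE; exact: (bartlett_row_law (i_gt0 i hi) (hZ i hi) (hG i hi) (hZG i hi)).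
have G0 i (hi : (2 <= i <= n)%N) : {ae Pr, forall w, 0 < G i w}.
  exact: chi2_law_gt0_ae (hG i hi).
have LE i j w : (1 <= j < i)%N -> vcoord (Z i w) j / Snorm (z w) (g w) i = L i j w.
  by move=> /andP[_ ji]; rewrite /L /bartlett_entry ltnNge (ltnW ji)/= ji.
have LdE i w : (1 < i)%N -> Num.sqrt (G i w) / Snorm (z w) (g w) i = L i i w.
  by move=> i1; rewrite /L /bartlett_entry ltnn (gtn_eqF i1).
have vineE i j w : 0 < G i w -> (1 <= j < i)%N ->
    P i j w * \prod_(1 <= k < j) Num.sqrt (1 - P i k w ^+ 2)
      = vcoord (Z i w) j / Snorm (z w) (g w) i.
  by move=> Gw ji; exact: (tail_ratio_prod_sqrt (X i) Gw ji).
have vinedE i w : 0 < G i w -> (1 < i)%N ->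
    \prod_(1 <= k < i) Num.sqrt (1 - P i k w ^+ 2)
      = Num.sqrt (G i w) / Snorm (z w) (g w) i.
  case: i => // i Gw i1.
  rewrite (prod_sqrt_tail_ratio (X i.+1) Gw (leqnn _)) /tail_sum.
  by rewrite big_geq// add0r.
split=> [i hi|].
  split=> [j w ji||]; last 2 first.
  - exact: row.
  - have [i1 _] := andP hi; apply: filterS (G0 i hi) => w Gw; split=> [j ji|].
      by rewrite vineE// LE.
    by rewrite vinedE// LdE.
  case: j ji => // j /= ji.
  rewrite /P /Pcor; congr (_ / Num.sqrt _); apply/esym.
  exact: (tail_sumS (X i) (G i) w ji).
split.
  apply: mutually_independentS hrows => i _.
  have [f mf fE] := measurable_bartlett_coupling R i.
  rewrite (_ : (fun w => (Pcor_row _ _ _, _)) = f \o (fun w => (Z i w, G i w))).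
    exact: preimage_set_system_compS.
  by apply/funext => w; rewrite fE.
have dom (j i : nat) : [&& 1 <= j, j < i & i <= n]%N ->
    (1 <= j < i)%N /\ (2 <= i <= n)%N.
  by move=> /and3P[j1 ji iN]; rewrite j1 ji iN (leq_ltn_trans j1 ji).
split.
  split; last first.
    by move=> j i /dom[ji hi]; have [_] := row i hi; exact.
  (* Group the pairs (j, i) by row, then within the row i by column. *)
  apply: (mutually_independent_grouped (h := snd)
    (f := fun i w => (Z i w, G i w))) hrows _.
  - by move=> ji /dom[].
  - move=> [j i] _ /=.
    rewrite (_ : P i j = tail_ratio i (fun k v => vcoord v.1 k) snd j \o
      (fun w => (Z i w, G i w)))//.
    apply: preimage_set_system_compS; apply: measurable_tail_ratio => // k.
    exact: (measurableT_comp (@measurable_vcoord R i.-1 k)).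
  move=> i hi; have [indP _] := row i hi.
  apply: (mutually_independent_grouped (h := fst) (f := P i)) indP _.
  - by move=> [j k] /= [/dom[jk _] <-].
  - by move=> [j k] /= [_ ->].
  move=> j _; apply: mutually_independent_subsingleton.
    move=> [j' i'] _ /=; exact: g_sigma_algebra_preimage_measurable.
  by move=> [j1 i1] [j2 i2] /= [[_ ->] ->] [[_ ->] ->].
have Gall : {ae Pr, forall w, forall i : nat, (2 <= i <= n)%N -> 0 < G i w}.
  apply: ae_foralln => i; have [hi|hi] := boolP (2 <= i <= n)%N.
    by apply: filterS (G0 i hi) => w.
  by apply: aeW => w.
apply: filterS Gall => w Gw; apply/matrixP => i j; rewrite !mxE.
have hi : (1 < i.+1)%N -> (2 <= i.+1 <= n)%N by rewrite ltn_ord andbT.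
rewrite /cvine_entry; have [ji|ij|ij] := ltngtP j.+1 i.+1.
- have i1 : (1 < i.+1)%N by apply: leq_trans ji.
  by rewrite vineE ?Gw ?hi// LE.
- by rewrite /bartlett_entry ij.
- rewrite ij; have [i1|i1] := ltnP 1 i.+1.
    by rewrite vinedE ?Gw ?hi// LdE.
  have -> : i = 0%N :> nat by case: (nat_of_ord i) i1.
  by rewrite big_geq// /bartlett_entry.
Qed.
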